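(* There is a $2$-DFAO with $25$ states that, for every $n\geq 1$, on input $(n)_2$ computes the least circular critical exponent over all factors of length $n$ of the Thue-Morse word $\mathbf{t}$, that is, $\min\{\mathrm{cce}(x) : x \text{ is a factor of } \mathbf{t},\ |x|=n\}$.
   Context: The Thue-Morse word $\mathbf{t} = t_0 t_1 t_2 \cdots = 01101001\cdots$ is the infinite fixed point, starting with $0$, of the morphism $\mu$ with $\mu(0)=01$, $\mu(1)=10$. A nonempty finite word $w$ (indexed from $0$) has period $p$, where $1 \le p \le |w|$, if $w[i]=w[i+p]$ for all $i$ with $0 \le i < |w|-p$. The smallest period of $w$ is denoted $p(w)$, and the exponent of $w$ is $\exp(w) = |w|/p(w)$. A factor of a word is a contiguous block inside it. The conjugates of a finite word $w$ are its cyclic shifts, i.e. the words $yx$ with $w = xy$ ($x,y$ possibly empty). The circular critical exponent $\mathrm{cce}(w)$ of a nonempty finite word $w$ is the supremum (maximum) of $\exp(x)$ over all nonempty factors $x$ of all conjugates of $w$. A $k$-DFAO (deterministic finite automaton with output) is $M=(Q,\Sigma_k,\delta,q_0,\Delta,\tau)$, where $Q$ is a finite nonempty set of states, $\Sigma_k=\{0,1,\ldots,k-1\}$ is the input alphabet, $\delta:Q\times\Sigma_k\to Q$ is the transition function (extended to $Q\times\Sigma_k^*$ in the usual way), $q_0\in Q$ is the initial state, $\Delta$ is the (finite) output alphabet (here a finite set of rational numbers), and $\tau:Q\to\Delta$ is the output map. On input $x \in \Sigma_k^*$ it outputs $\tau(\delta(q_0,x))$. $(n)_2$ denotes the base-$2$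 representation of $n$, read starting with the most significant digit. *)

(* Defs.v *)
From mathcomp Require Import all_boot all_order all_algebra.

Set Implicit Arguments.
Unset Strict Implicit.
Unset Printing Implicit Defensive.

Import Order.TTheory GRing.Theory Num.Theory.

(* The letters 0 and 1 are [false] and [true]. *)
Definition mu (w : seq bool) : seq bool :=
  flatten [seq [:: b; ~~ b] | b <- w].

(* [iter n mu [:: false]] is a prefix of the fixed point, of length 2 ^ n > n. *)
Definition thue_morse (n : nat) : bool := nth false (iter n mu [:: false]) n.

Definition block (t : nat -> bool) (i n : nat) : seq bool :=
  mkseq (fun j => t (i + j)) n.

Definition tm_factor (x : seq bool) : Prop :=
  exists i, x = block thue_morse i (size x).

Definition has_period (w : seq bool) (p : nat) : bool :=
  (1 <= p <= size w) &&
  [forall i : 'I_(size w - p), nth false w i == nth false w (i + p)].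

(* A nonempty [w] has period [size w], so the default of the minimum is one of
   the competing values. *)
Definition period (w : seq bool) : nat :=
  \big[minn/size w]_(1 <= p < (size w).+1 | has_period w p) p.

Definition exponent (w : seq bool) : rat := ((size w)%:R / (period w)%:R)%R.

Definition conjugates (w : seq bool) : seq (seq bool) :=
  [seq rot i w | i <- iota 0 (size w).+1].

(* The nonempty factors of [w]. *)
Definition factors (w : seq bool) : seq (seq bool) :=
  [seq take l (drop i w) | i <- iota 0 (size w), l <- iota 1 (size w - i)].

(* All exponents are positive, so the default 0 of the maxima is harmless when
   [w] is nonempty. *)
Definition cce (w : seq bool) : rat :=
  \big[Num.max/0%R]_(c <- conjugates w)
    \big[Num.max/0%R]_(x <- factors c) exponent x.

Definition is_minimum (A : rat -> Prop) (m : rat) : Prop :=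
  A m /\ forall r, A r -> (m <= r)%R.

(* A DFAO with input alphabet {0, ..., k - 1} and outputs in [T]. The sequence
   [dfao_alphabet] lists the finite output alphabet. *)
Record dfao (k : nat) (T : eqType) := Dfao {
  dfao_state : finType;
  dfao_trans : dfao_state -> 'I_k -> dfao_state;
  dfao_init : dfao_state;
  dfao_alphabet : seq T;
  dfao_out : dfao_state -> T;
  dfao_outP : forall q, dfao_out q \in dfao_alphabet
}.

Definition dfao_run (k : nat) (T : eqType) (M : dfao k T) (x : seq 'I_k) : T :=
  dfao_out (foldl (@dfao_trans k T M) (dfao_init M) x).

(* For n >= 1, the base-2 digits of n, most significant first, without leading
   zeros: the digit of weight 2 ^ i is floor (n / 2 ^ i) mod 2. *)
Definition base2 (n : nat) : seq 'I_2 :=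
  rev (mkseq (fun i => inZp (n %/ 2 ^ i) : 'I_2) (trunc_log 2 n).+1).

(* Adequacy of the encodings above. *)

Lemma size_mu w : size (mu w) = (size w).*2.
Proof. by elim: w => //= b w ->. Qed.

Lemma nth_mu w i : i < size w ->
  (nth false (mu w) i.*2 = nth false w i)
  * (nth false (mu w) i.*2.+1 = ~~ nth false w i).
Proof. by elim: w i => [|b w IHw] [|i] //= lti; apply: IHw. Qed.

Lemma size_iter_mu n : size (iter n mu [:: false]) = 2 ^ n.
Proof. by elim: n => //= n IHn; rewrite size_mu IHn expnS mul2n. Qed.

Lemma nth_iter_mu m n i : m <= n -> i < 2 ^ m ->
  nth false (iter n mu [:: false]) i = nth false (iter m mu [:: false]) i.
Proof.
elim: m n i => [|m IHm] [|n] [|i] // lemn lti.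
- by elim: n.+1 => //= k; case: (iter k _ _).
- have -> : nth false (iter n.+1 mu [:: false]) 0 = false.
    by elim: n.+1 => //= k; case: (iter k _ _).
  by elim: m.+1 => //= k; case: (iter k _ _).
have lt2 : i.+1./2 < 2 ^ m by rewrite ltn_half_double -mul2n -expnS.
have lt2n : i.+1./2 < 2 ^ n by rewrite (leq_trans lt2) ?leq_exp2l.
rewrite -(odd_double_half i.+1) !iterS.
by case: (odd i.+1); rewrite !nth_mu ?size_iter_mu // IHm.
Qed.

(* [thue_morse] is the fixed point of [mu] starting with 0. *)
Lemma thue_morse0 : thue_morse 0 = false.
Proof. by []. Qed.

Lemma thue_morse_fixed n :
  mu (block thue_morse 0 n) = block thue_morse 0 n.*2.
Proof.
have tm_nth m i : i < 2 ^ m ->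
    thue_morse i = nth false (iter m mu [:: false]) i.
  move=> lti; rewrite /thue_morse; have [leim|/ltnW lemi] := leqP i m.
    by rewrite (nth_iter_mu leim) // ltn_expl.
  by rewrite (nth_iter_mu lemi).
apply: (@eq_from_nth _ false) => [|i]; rewrite size_mu !size_mkseq // => lti.
have lt2 : i./2 < n by rewrite ltn_half_double.
have lt2n : i./2 < 2 ^ n by apply: ltn_trans lt2 _; apply: ltn_expl.
have ltin : i < 2 ^ n.+1 by rewrite expnS mul2n -ltn_half_double.
rewrite nth_mkseq // add0n (tm_nth n.+1) //= -(odd_double_half i).
by case: (odd i); rewrite !nth_mu ?size_mkseq ?size_iter_mu // nth_mkseq //
  add0n (tm_nth n).
Qed.

Lemma periodP w : w != [::] ->
  has_period w (period w) /\ forall p, has_period w p -> period w <= p.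
Proof.
move=> w_neq0.
have sz : has_period w (size w).
  rewrite /has_period lt0n size_eq0 w_neq0 leqnn /=.
  by apply/forallP => -[i]; rewrite subnn.
split.
  apply: (big_ind (fun p => has_period w p)) => // p q hp hq.
  by rewrite /minn; case: ifP.
move=> p hp; have /andP[/andP[p_gt0 lepw] _] := hp.
rewrite /period.
have : p \in index_iota 1 (size w).+1 by rewrite mem_index_iota p_gt0 ltnS.
elim: (index_iota _ _) => // q s IHs; rewrite inE big_cons => /orP[/eqP<-|/IHs le].
  by rewrite hp geq_minl.
by case: ifP => // _; rewrite (leq_trans (geq_minr _ _)).
Qed.

Lemma conjugatesP w c :
  reflect (exists x y, w = x ++ y /\ c = y ++ x) (c \in conjugates w).
Proof.
apply: (iffP mapP) => [[i _ ->]|[x [y [-> ->]]]].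
  by exists (take i w), (drop i w); rewrite cat_take_drop.
exists (size x); last by rewrite rot_size_cat.
by rewrite mem_iota add0n ltnS size_cat leq_addr.
Qed.

Lemma factorsP w x : (x \in factors w) = (x != [::]) && infix x w.
Proof.
apply/allpairsPdep/andP => [[i [l [+ + ->]]]|[x0 /infixP[p [s ->]]]].
  rewrite !mem_iota => /andP[_ lti] /andP[l_gt0 ltl]; split.
    by rewrite -size_eq0 size_takel ?size_drop -?lt0n //; rewrite add1n ltnS in ltl.
  apply/infixP; exists (take i w), (drop l (drop i w)).
  by rewrite !cat_take_drop.
exists (size p), (size x); rewrite !mem_iota !size_cat drop_size_cat //.
rewrite take_size_cat // -size_eq0 -lt0n in x0 *; rewrite x0 addKn.
split=> //=; last by rewrite add1n ltnS leq_addr.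
by rewrite add0n -[X in X < _]addn0 ltn_add2l ltn_addr.
Qed.

Lemma cceP w : w != [::] ->
  (exists c x, [/\ c \in conjugates w, x \in factors c & cce w = exponent x])
  /\ forall c x, c \in conjugates w -> x \in factors c ->
     (exponent x <= cce w)%R.
Proof.
move=> w_neq0.
have exp_ge0 x : (0 <= exponent x)%R by rewrite divr_ge0 ?ler0n.
have max_ge (I : eqType) (r : seq I) (F : I -> rat) i : i \in r ->
    (F i <= \big[Num.max/0%R]_(j <- r) F j)%R.
  by move=> ir; apply: le_bigmax_seq.
have max_at (I : eqType) (r : seq I) (F : I -> rat) : r != [::] ->
    (forall i, 0 <= F i)%R ->
    exists2 i, i \in r & \big[Num.max/0%R]_(j <- r) F j = F i.
  move=> + F0; elim: r => // i [|j r] IHr _.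
    by exists i; rewrite ?inE // big_seq1_id; apply/max_idPl.
  have [//|k kr Ek] := IHr; rewrite big_cons Ek.
  have [le|lt] := leP (F i) (F k); last by exists i; rewrite ?mem_head.
  by exists k => //; rewrite inE kr orbT.
have max_ge0 c : (0 <= \big[Num.max/0%R]_(x <- factors c) exponent x)%R.
  exact: bigmax_ge_id.
split; last first.
  move=> c x cw xc; apply: (le_trans (max_ge _ _ _ _ xc)).
  exact: (max_ge _ _ (fun c => \big[Num.max/0%R]_(x <- factors c) exponent x)).
have [//|c cw Ec] := max_at _ (conjugates w) _ _ max_ge0.
have c_neq0 : c != [::].
  case/mapP: (cw) => i _ ->.
  by rewrite -size_eq0 size_rot size_eq0.
have fc : factors c != [::].
  have : c \in factors c by rewrite factorsP c_neq0 infix_refl.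
  by case: (factors c).
have [x xc Ex] := max_at _ (factors c) _ fc exp_ge0.
by exists c, x; split=> //; rewrite /cce Ec.
Qed.

Lemma base2P n : 0 < n ->
  foldl (fun m (d : 'I_2) => 2 * m + d) 0 (base2 n) = n
  /\ head ord0 (base2 n) = 1%R.
Proof.
move=> n_gt0; have /andP[le_n lt_n] : 2 ^ trunc_log 2 n <= n < 2 ^ (trunc_log 2 n).+1.
  exact: trunc_log_bounds.
rewrite /base2; split.
  rewrite foldl_rev; move: (trunc_log 2 n).+1 lt_n => k {le_n n_gt0}.
  elim: k n => [|k IHk] n.
    by rewrite expn0 ltnS leqn0 => /eqP ->.
  move=> ltn; rewrite /mkseq /= expn0 divn1 -(addn0 1) iotaDl -map_comp.
  rewrite (eq_map (g := fun i => inZp (n %/ 2 %/ 2 ^ i) : 'I_2)); last first.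
    by move=> i; apply: val_inj; rewrite /= add1n expnS divnMA.
  rewrite IHk; last by rewrite ltn_divLR // mulnC -expnS.
  by rewrite mulnC -divn_eq.
rewrite /mkseq -[(trunc_log 2 n).+1]addn1 iotaD map_cat rev_cat /= add0n.
apply: val_inj => /=.
have -> : n %/ 2 ^ trunc_log 2 n = 1; last by [].
apply/eqP; rewrite eqn_leq -ltnS ltn_divLR ?expn_gt0 // -expnS lt_n /=.
by rewrite leq_divRL ?expn_gt0 // mul1n.
Qed.

(* Main.v *)
(* Let f(n) be the least circular critical exponent over the factors of length n.
   For n >= 4, f(2n) = f(n): applying mu to a circular word keeps its exponents
   above 2, and a factor of even length 2n starting at an odd position is either
   conjugate to the image under mu of a factor of length n, or contains a
   5/2-power at its junction, while f <= 5/2.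
   For odd n = 16 m + r >= 17, f(n) is decided by the 33 letters around the
   junction of the circular word. From below, a repetition of period at most 7
   around the junction attains f(n) for every factor. From above, some factor
   has 00100 or 11011, which do not occur in t, across its junction; this
   excludes the exponents above 7/3 for the periods at least 9, and the smaller
   periods are read off the 33 letters. These letters are determined
   by r, the position of the factor modulo 16, and a pair of short factors of t
   at distance m; the set of these pairs is a finite-state function of the binary
   digits of m, so finitely many computations settle all lengths. *)

Require Import Defs.
From mathcomp Require Import all_boot all_order all_algebra.
From mathcomp Require Import zify.

Set Implicit Arguments.
Unset Strict Implicit.
Unset Printing Implicit Defensive.

Import Order.TTheory GRing.Theory Num.Theory.

(** * Repetitions and the morphism mu *)

Lemma seq_neq0 (x : seq bool) : (x != [::]) = (0 < size x).
Proof. by case: x. Qed.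

Definition rep (c : nat -> bool) (i p l : nat) : Prop :=
  forall j, j + p < l -> c (i + j) = c (i + j + p).

(** [w] is the image of the infinite word [c] under [mu]. *)
Definition doubles (c w : nat -> bool) : Prop :=
  forall j, w j.*2 = c j /\ w j.*2.+1 = ~~ c j.

Lemma rep_sub c i p l s l' : s + l' <= l -> rep c i p l -> rep c (i + s) p l'.
Proof.
by move=> le_l cr j ltj; rewrite -(addnA i) cr //; lia.
Qed.

Lemma eq_rep c c' i i' p l :
  (forall j, j < l -> c (i + j) = c' (i' + j)) -> rep c i p l -> rep c' i' p l.
Proof.
move=> eqc cr j ltj; rewrite -eqc; last lia.
by rewrite -addnA -eqc // addnA cr.
Qed.

(** The two letters from an even position differ, and an odd period carries this to the odd
    positions. The letters then alternate, so two at odd distance [p] differ. *)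
Lemma doubles_rep_odd c w i p l :
  doubles c w -> 0 < p -> p.*2 < l -> rep w i p l -> ~~ odd p.
Proof.
move=> cw p_gt0 ltl wr; apply/negP=> odd_p.
have even_step j : ~~ odd j -> w j.+1 = ~~ w j.
  move=> even_j; have := odd_double_half j; rewrite (negPf even_j) add0n => <-.
  by case: (cw j./2) => -> ->.
have step j : j < p -> w (i + j).+1 = ~~ w (i + j).
  move=> ltj; have [odd_ij|] := boolP (odd (i + j)); last exact: even_step.
  have := wr j; have := wr j.+1; rewrite addnS addSn => -> ; last lia.
  by move=> ->; [rewrite even_step // oddD odd_ij odd_p | lia].
have alt j : j <= p -> w (i + j) = odd j (+) w i.
  elim: j => [|j IHj] lej; first by rewrite addn0.
  by rewrite addnS step // IHj ?(ltnW lej) //= addNb.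
have := wr 0; rewrite addn0 alt // odd_p => /(_ _) E.
by have := E ltac:(lia); case: (w i).
Qed.

(** Either letter of an image under [mu] determines its source, so half an image at an end of the
    repetition still yields a letter of [c]; hence [uphalf l]. *)
Lemma doubles_rep_halve c w i q l : doubles c w -> q.*2 < l ->
  rep w i q.*2 l -> rep c i./2 q (uphalf l).
Proof.
move=> cw ltl wr j ltj.
have cE k : c k = w k.*2 by case: (cw k).
have [le_ij|lt_ji] := leqP i (i./2 + j).*2.
  rewrite !cE; have := wr ((i./2 + j).*2 - i); rewrite subnKC // doubleD => ->.
    by congr (w _); lia.
  by lia.
(* Only [j = 0] with [i] odd is left: the first image is cut, and its second letter serves. *)
have nE k : c k = ~~ w k.*2.+1 by case: (cw k) => _ ->; rewrite negbK.
rewrite !nE; congr (~~ _).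
have -> : (i./2 + j).*2.+1 = i + 0 by lia.
rewrite wr; last lia.
by congr (w _); lia.
Qed.

Lemma doubles_rep_double c w i p l : doubles c w ->
  rep c i p l -> rep w i.*2 p.*2 l.*2.
Proof.
move=> cw cr j ltj.
have E k : w k = odd k (+) c k./2.
  rewrite -{1}(odd_double_half k); case: (cw k./2) => w0 w1.
  by case: (odd k); rewrite /= ?add1n ?add0n ?w0 ?w1.
rewrite !E !oddD !odd_double addbF; congr (_ (+) _).
have -> : (i.*2 + j)./2 = i + j./2 by lia.
rewrite cr; last lia.
by congr (c _); lia.
Qed.

Lemma nth_block c i n j : j < n -> nth false (block c i n) j = c (i + j).
Proof. exact: nth_mkseq. Qed.

Lemma size_block c i n : size (block c i n) = n.
Proof. exact: size_mkseq. Qed.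

Lemma eq_block c c' i i' n : (forall j, j < n -> c (i + j) = c' (i' + j)) ->
  block c i n = block c' i' n.
Proof.
move=> eqc; apply: (@eq_from_nth _ false) => [|j]; rewrite !size_block // => ltj.
by rewrite !nth_block // eqc.
Qed.

Lemma block_cat c i m n : block c i (m + n) = block c i m ++ block c (i + m) n.
Proof.
rewrite /block /mkseq iotaD map_cat add0n -[in iota m n](addn0 m) iotaDl -map_comp.
by congr (_ ++ _); apply: eq_map => j /=; rewrite addnA.
Qed.

Lemma sub_block c i n s l : s + l <= n ->
  take l (drop s (block c i n)) = block c (i + s) l.
Proof.
move=> le_n; rewrite -(subnKC le_n) -addnA block_cat drop_size_cat ?size_block //.
by rewrite block_cat take_size_cat ?size_block.
Qed.

Lemma drop_block c i n s : s <= n -> drop s (block c i n) = block c (i + s) (n - s).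
Proof.
by move=> les; rewrite -{1}(subnKC les) block_cat drop_size_cat ?size_block.
Qed.

Lemma take_block c i n l : l <= n -> take l (block c i n) = block c i l.
Proof.
by move=> lel; rewrite -{1}(subnKC lel) block_cat take_size_cat ?size_block.
Qed.

Lemma mu_block c w j n : doubles c w -> mu (block c j n) = block w j.*2 n.*2.
Proof.
move=> cw; apply: (@eq_from_nth _ false) => [|k]; rewrite size_mu !size_block //.
move=> ltk; have ltk2 : k./2 < n by lia.
rewrite nth_block // -[in LHS](odd_double_half k).
have [w0 w1] := cw (j + k./2).
have [|m0 m1] := @nth_mu (block c j n) k./2; first by rewrite size_block.
case: (boolP (odd k)) => odd_k.
  by rewrite add1n m1 nth_block // -w1; congr (w _); lia.
by rewrite add0n m0 nth_block // -w0; congr (w _); lia.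
Qed.

Lemma thue_morse_double : doubles thue_morse thue_morse.
Proof.
move=> j; have := thue_morse_fixed j.+1.
set b := block _ 0 j.+1 => E.
have [] := nth_mu (w := b) (i := j) ltac:(rewrite size_block; lia).
rewrite E !nth_block ?add0n; [|lia|lia|lia].
by move=> -> ->.
Qed.

Lemma iter_mu_thue_morse k j n :
  iter k mu (block thue_morse j n) = block thue_morse (2 ^ k * j) (2 ^ k * n).
Proof.
elim: k => [|k IHk]; first by rewrite !mul1n.
by rewrite iterS IHk (mu_block _ _ thue_morse_double) expnS -!mul2n !mulnA.
Qed.

(** Descent on the period: it is even, and halving gives another overlap. *)
Lemma thue_morse_overlap_free i p l :
  0 < p -> p.*2 < l -> ~ rep thue_morse i p l.
Proof.
elim/ltn_ind: p i l => p IHp i l p_gt0 ltl tr.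
have even_p := doubles_rep_odd thue_morse_double p_gt0 ltl tr.
have pE : p = p./2.*2 by lia.
rewrite pE in tr ltl.
apply: (IHp p./2 _ i./2 (uphalf l)); try lia.
by apply: doubles_rep_halve thue_morse_double _ tr; lia.
Qed.

(** * Circular words *)

(** The periodic extension of [x]: the factors of its conjugates are the nonempty blocks of length
    at most [size x]. *)
Definition circ (x : seq bool) (i : nat) : bool := nth false x (i %% size x).

Lemma circ_block x r : r <= size x -> rot r x = block (circ x) r (size x).
Proof.
move=> ler; apply: (@eq_from_nth _ false) => [|j].
  by rewrite size_rot size_block.
rewrite size_rot => ltj; rewrite nth_block // /circ /rot nth_cat size_drop.
case: ltnP => lej; first by rewrite nth_drop modn_small //; lia.
rewrite nth_take; last lia.
have -> : r + j = (j - (size x - r)) + size x by lia.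
by rewrite modnDr modn_small //; lia.
Qed.

Lemma circ_block_left c i n k : k < n -> circ (block c i n) k = c (i + k).
Proof. by move=> ltk; rewrite /circ size_block modn_small // nth_block. Qed.

Lemma circ_block_right c i n k : k < n ->
  circ (block c i n) (n + k) = c (i + k).
Proof. by move=> ltk; rewrite /circ size_block modnDl modn_small // nth_block. Qed.

Lemma junction_circ c i n a b : a <= n -> b <= n ->
  block c (i + (n - a)) a ++ block c i b
  = block (circ (block c i n)) (n - a) (a + b).
Proof.
move=> lea leb; rewrite block_cat; congr (_ ++ _); apply: eq_block => j ltj.
  by rewrite circ_block_left -?addnA //; lia.
by rewrite subnK // circ_block_right //; lia.
Qed.

Lemma self_cat_circ x : x ++ x = block (circ x) 0 (size x + size x).
Proof.
have {1 2}-> : x = block (nth false x) 0 (size x).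
  apply: (@eq_from_nth _ false) => [|k ltk]; first by rewrite size_block.
  by rewrite nth_block.
rewrite block_cat; congr (_ ++ _); apply: eq_block => k ltk.
  by rewrite /circ modn_small.
by rewrite /circ modnDl modn_small.
Qed.

Lemma has_period_block c i l p :
  0 < p <= l -> reflect (rep c i p l) (has_period (block c i l) p).
Proof.
move=> /andP[p_gt0 lep]; rewrite /has_period size_block p_gt0 lep /=.
apply: (iffP forallP) => [per j ltj|cr [j ltj]].
  have ltj' : j < l - p by lia.
  have /eqP := per (Ordinal ltj').
  by rewrite /= !nth_block ?addnA //; lia.
apply/eqP.
by rewrite /= !nth_block ?addnA ?cr //; lia.
Qed.

Definition ratio (e : nat * nat) : rat := (e.1%:R / e.2%:R)%R.

Lemma ratio_le e f : 0 < e.2 -> 0 < f.2 ->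
  (ratio e <= ratio f)%R = (e.1 * f.2 <= f.1 * e.2).
Proof.
move=> e_gt0 f_gt0; rewrite /ratio ler_pdivrMr ?ltr0n // mulrAC.
by rewrite ler_pdivlMr ?ltr0n // -!natrM ler_nat.
Qed.

Lemma le_cce x i p l : 0 < p <= l -> l <= size x -> rep (circ x) i p l ->
  (ratio (l, p) <= cce x)%R.
Proof.
move=> /andP[p_gt0 le_pl] le_l cr.
have x0 : x != [::] by rewrite seq_neq0; lia.
have [_ max_x] := cceP x0.
set r := i %% size x; have ltr : r < size x by rewrite ltn_mod; lia.
have cr' : rep (circ x) r p l.
  by apply: eq_rep cr => j _; rewrite /circ /r modnDml.
have wE := @sub_block (circ x) r (size x) 0 l ltac:(lia).
rewrite addn0 drop0 -circ_block ?(ltnW ltr) // in wE.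
set w := take l _ in wE.
have szw : size w = l by rewrite wE size_block.
have w0 : w != [::] by rewrite seq_neq0 szw; lia.
have le_w : (exponent w <= cce x)%R.
  apply: (max_x (rot r x)).
    by apply/mapP; exists r => //; rewrite mem_iota; lia.
  rewrite factorsP w0; apply/infixP; exists [::], (drop l (rot r x)).
  by rewrite cat_take_drop.
apply: le_trans le_w; have [hp min_w] := periodP w0.
have per_gt0 : 0 < period w by case/andP: hp => /andP[].
rewrite -[exponent w]/(ratio (size w, period w)) ratio_le //= szw.
rewrite leq_mul2l min_w ?orbT // wE.
by apply/has_period_block; rewrite ?p_gt0.
Qed.

Lemma cce_le (x : seq bool) e : x != [::] ->
  (forall i p l, i < size x -> 0 < p <= l -> l <= size x ->
     rep (circ x) i p l -> (ratio (l, p) <= e)%R) ->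
  (cce x <= e)%R.
Proof.
move=> x0 le_e; have [[c [w [/mapP[r + ->] + ->]]] _] := cceP x0.
rewrite mem_iota /= ltnS => ler.
rewrite circ_block // => /allpairsPdep[i [l []]].
rewrite !mem_iota size_block => lti ltl wE.
have {}wE : w = block (circ x) (r + i) l by rewrite wE sub_block //; lia.
have w0 : w != [::] by rewrite seq_neq0 wE size_block; lia.
have szw : size w = l by rewrite wE size_block.
have [hp _] := periodP w0; have /andP[lep _] := hp; rewrite szw in lep.
rewrite -[exponent w]/(ratio (size w, period w)) szw.
apply: (le_e ((r + i) %% size x)) => //; [by rewrite ltn_mod -seq_neq0| |].
  by rewrite add1n ltnS in ltl; case/andP: ltl => _ /leq_trans-> //; apply: leq_subr.
rewrite {1}wE in hp; move/(has_period_block _ _ lep): hp.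
by apply: eq_rep => j _; rewrite /circ modnDml.
Qed.

(** * Computable tests for repetitions *)

Fixpoint has_run (k c : nat) (bs : seq bool) : bool :=
  if c is c'.+1 then
    if bs is b :: bs' then has_run k (if b then c' else k) bs' else false
  else true.

(** The counter [c] is what the current run still misses: success completes that run at the head or
    finds a full run later. *)
Lemma has_runE k c bs : c <= k ->
  has_run k c bs = prefix (nseq c true) bs || infix (nseq k true) bs.
Proof.
elim: bs c => [|b bs IHbs] [|c] lec; rewrite ?prefix0s //; first by case: k lec.
have -> : infix (nseq k true) (b :: bs) =
    prefix (nseq k true) (b :: bs) || infix (nseq k true) bs by [].
case: k lec IHbs => // k lec IHbs; rewrite /= IHbs; last by case: (b); lia.
case: b => /=; last first.
  by apply/orP/idP => [[/prefixW|]|->] //; right.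
rewrite orbA; congr (_ || _); apply/idP/orP => [->|[]//]; first by left.
have -> : nseq k true = nseq c true ++ nseq (k - c) true.
  by rewrite -nseqD subnKC.
exact: catl_prefix.
Qed.

Definition matches (w : seq bool) (p : nat) : seq bool :=
  [seq x.1 == x.2 | x <- zip w (drop p w)].

Definition has_rep (w : seq bool) (p l : nat) : bool :=
  has_run (l - p) (l - p) (matches w p).

Lemma infix_nseqP k bs :
  reflect (exists2 s, s + k <= size bs & forall j, j < k -> nth false bs (s + j))
          (infix (nseq k true) bs).
Proof.
refine (iffP (@infixP _ _ _) _ _) => [[b1 [b2 ->]]|[s le_s all_s]].
  exists (size b1) => [|j ltj]; first by rewrite !size_cat size_nseq leq_add2l leq_addr.
  by rewrite nth_cat ltnNge leq_addr /= addKn nth_cat size_nseq ltj nth_nseq ltj.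
exists (take s bs), (drop k (drop s bs)).
rewrite -[LHS](cat_take_drop s); congr (_ ++ _).
rewrite -[LHS](cat_take_drop k); congr (_ ++ _).
have sz : size (take k (drop s bs)) = k by rewrite size_takel // size_drop; lia.
apply: (@eq_from_nth _ false) => [|j]; rewrite sz ?size_nseq // => ltj.
by rewrite nth_take // nth_drop nth_nseq ltj all_s.
Qed.

Lemma has_repP c i n p l : p <= l <= n ->
  reflect (exists2 s, s + l <= n & rep c (i + s) p l)
          (has_rep (block c i n) p l).
Proof.
move=> /andP[le_p le_l].
have sz : size (matches (block c i n) p) = n - p.
  by rewrite size_map size_zip size_drop size_block; lia.
have mE s : s < n - p ->
    nth false (matches (block c i n) p) s = (c (i + s) == c (i + s + p)).
  move=> lts; have lts' : s < size (zip (block c i n) (drop p (block c i n))).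
    by rewrite size_zip size_drop size_block; lia.
  rewrite (nth_map (false, false)) // nth_zip_cond lts' /=.
  by rewrite nth_drop !nth_block; [|lia|lia]; congr (_ == c _); lia.
rewrite /has_rep has_runE //.
have -> : forall k bs, prefix (nseq k true) bs || infix (nseq k true) bs
    = infix (nseq k true) bs.
  by move=> k bs; apply/orP/idP => [[/prefixW|]|->] //; right.
apply: (iffP (infix_nseqP _ _)); rewrite sz => -[s les hs].
  exists s => [|j ltj]; first lia.
  by have := hs j ltac:(lia); rewrite mE; [move/eqP; rewrite addnA|lia].
exists s => [|j ltj]; first lia.
by rewrite mE ?addnA ?hs //; lia.
Qed.

(* [has] short-circuits under call by value only in this form. *)
Definition lazy_has (T : Type) (a : pred T) (s : seq T) : bool :=
  find a s < size s.

Lemma lazy_hasE (T : Type) (a : pred T) s : lazy_has a s = has a s.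
Proof. by rewrite has_find. Qed.

(* The least length of a repetition of period p and exponent at least e.1 / e.2
   is [(e.1 * p + e.2.-1) %/ e.2]; for an exponent larger than e.1 / e.2 it is
   [((e.1 * p) %/ e.2).+1]. *)
Definition attains (e : nat * nat) (n : nat) (w : seq bool) : bool :=
  lazy_has (fun p => let l := (e.1 * p + e.2.-1) %/ e.2 in
    if p <= l <= n then has_rep w p l else false) (iota 1 7).

Definition avoids (e : nat * nat) (n k : nat) (w : seq bool) : bool :=
  all (fun p => let l := ((e.1 * p) %/ e.2).+1 in
    if p <= l <= n then ~~ has_rep w p l else true) (iota 1 k).

Lemma attains_le_cce e n x i m : 0 < e.2 -> n <= size x -> n <= m ->
  attains e n (block (circ x) i m) -> (ratio e <= cce x)%R.
Proof.
move=> e_gt0 le_n le_m; rewrite /attains lazy_hasE => /hasP[p].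
rewrite mem_iota => /andP[p_gt0 _] /=.
set l := _ %/ _; case: ifP => // /andP[le_p le_l].
have le_plm : p <= l <= m by rewrite le_p (leq_trans le_l).
move/(has_repP _ _ le_plm) => [s les sr].
apply: le_trans (le_cce (l := l) _ _ sr); [|lia|lia].
rewrite ratio_le //= /l; nia.
Qed.

(** A repetition of exponent above [e] contains one of the least such length for its period, the
    only length that [avoids] tests. *)
Lemma avoids_rep e n k c i m p l : e.1 >= e.2 -> 0 < e.2 -> n <= m ->
  avoids e n k (block c i m) -> 0 < p <= k ->
  e.1 * p < l * e.2 -> l <= n -> forall s, s + l <= m -> ~ rep c (i + s) p l.
Proof.
move=> e_ge1 e_gt0 le_n /allP av lep lt_e le_l s les sr.
have := av p; rewrite mem_iota => /(_ ltac:(lia)) /=.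
set l' := (_ %/ _).+1; have le_l' : l' <= l by rewrite /l' ltn_divLR.
have le_p : p <= l' by rewrite /l' ltnW // ltnS leq_divRL //; nia.
rewrite le_p (leq_trans le_l') // => /negP[].
apply/has_repP; first lia.
exists s; first lia.
by have := rep_sub (s := 0) (l' := l') _ sr; rewrite addn0; apply.
Qed.

(** * Doubling the length of a circular word *)

Lemma doubles_circ (x : seq bool) : x != [::] -> doubles (circ x) (circ (mu x)).
Proof.
rewrite seq_neq0 => x_gt0 j; rewrite /circ size_mu.
have E := divn_eq j (size x); have ltj : j %% size x < size x by rewrite ltn_mod.
have E0 : j.*2 = j %/ size x * (size x).*2 + (j %% size x).*2.
  by rewrite {1}E doubleD doubleMr.
have E1 : j.*2.+1 = j %/ size x * (size x).*2 + (j %% size x).*2.+1.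
  by rewrite addnS -E0.
rewrite E1 E0 !modnMDl; move: (j %% _) ltj => r ltr.
rewrite !modn_small ?ltn_Sdouble ?ltn_double //.
by have [-> ->] := nth_mu ltr.
Qed.

(** Exponents up to 2 are covered by the bound on [e]; a repetition above 2 has even period and
    halves to one in [x] of no smaller exponent. *)
Lemma cce_mu_le (x : seq bool) e : x != [::] -> (ratio (2, 1) <= e)%R -> (cce x <= e)%R ->
  (cce (mu x) <= e)%R.
Proof.
move=> x0 le2 le_e; have x_gt0 := x0; rewrite seq_neq0 in x_gt0.
apply: cce_le => [|i p l lti lep lel pr].
  by rewrite seq_neq0 size_mu; lia.
rewrite size_mu in lel lti.
have [le_lp|lt_pl] := leqP l p.*2.
  by apply: le_trans le2; rewrite ratio_le //=; lia.
have p_gt0 : 0 < p by lia.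
have even_p := doubles_rep_odd (doubles_circ x0) p_gt0 lt_pl pr.
have pE : p = p./2.*2 by lia.
have lt_q : p./2.*2 < l by lia.
rewrite pE in pr.
have half_p : 0 < p./2 <= uphalf l by lia.
have half_l : uphalf l <= size x by lia.
have := le_cce half_p half_l (doubles_rep_halve (doubles_circ x0) lt_q pr).
move=> /le_trans/(_ le_e); apply: le_trans; rewrite ratio_le /=; [|lia|lia].
by rewrite [X in _ <= _ * X]pE -doubleMr doubleMl leq_mul2r; lia.
Qed.

Lemma le_cce_mu (x : seq bool) : x != [::] -> (cce x <= cce (mu x))%R.
Proof.
move=> x0; apply: cce_le => // i p l lti lep lel pr.
have double_p : 0 < p.*2 <= l.*2 by lia.
have double_l : l.*2 <= size (mu x) by rewrite size_mu; lia.
have := le_cce double_p double_l (doubles_rep_double (doubles_circ x0) pr).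
apply: le_trans.
rewrite ratio_le /=; [|lia|lia].
by rewrite -doubleMr -doubleMl.
Qed.

Lemma cce_shift (x y : seq bool) s : size x = size y -> x != [::] ->
  (forall k, circ y (s + k) = circ x k) -> (cce x <= cce y)%R.
Proof.
move=> szxy x0 xy; apply: cce_le => // i p l lti lep lel pr.
apply: (le_cce (i := s + i)) => //; first by rewrite -szxy.
by apply: eq_rep pr => j _; rewrite -xy addnA.
Qed.

Definition least_cce (n : nat) (e : rat) : Prop :=
  (exists i, cce (block thue_morse i n) <= e)%R /\
  forall i, (e <= cce (block thue_morse i n))%R.

(* An equal pair of letters at the junction of a circular word of even length
   whose blocks are otherwise of the form 01 or 10 always creates a 5/2-power. *)
Lemma attains_misaligned b c d e f :
  attains (5, 2) 8 [:: d; ~~ d; c; ~~ c; b; b; e; ~~ e; f; ~~ f].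
Proof. by case: b; case: c; case: d; case: e; case: f; vm_compute. Qed.

Lemma least_cce_double n e : 4 <= n ->
  (ratio (2, 1) <= e)%R -> (e <= ratio (5, 2))%R ->
  least_cce n e -> least_cce n.*2 e.
Proof.
move=> le4n le2 le52 [[i lei] ge_e].
have bl0 k : block thue_morse k n != [::] by rewrite seq_neq0 size_block; lia.
have muE k : mu (block thue_morse k n) = block thue_morse k.*2 n.*2.
  exact: mu_block thue_morse_double.
split; first by exists i.*2; rewrite -muE; apply: cce_mu_le.
move=> {lei}i; have := odd_double_half i; set j := i./2; case: odd => /= <-.
  rewrite add1n; have [eq_j|neq_j] := eqVneq (thue_morse (j + n)) (thue_morse j).
    (* The last and the first letter form the image of [thue_morse j] across the junction, so a
       cyclic shift by one realigns the factor with an image under [mu]. *)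
    apply: le_trans (ge_e j.+1) _; apply: le_trans (le_cce_mu (bl0 _)) _.
    apply: (cce_shift (s := 1)); rewrite ?seq_neq0 ?size_mu ?size_block //; first lia.
    move=> k; rewrite muE /circ !size_block -(modnDmr 1).
    have : k %% n.*2 < n.*2 by rewrite ltn_mod; lia.
    move: (k %% _) => {}k ltk; have [ltk1|] := ltnP (1 + k) n.*2.
      by rewrite modn_small // !nth_block //; congr thue_morse; lia.
    move=> gek; have -> : k = n.*2.-1 by lia.
    have -> : 1 + n.*2.-1 = n.*2 by lia.
    rewrite modnn !nth_block ?addn0; try lia.
    have -> : j.+1.*2 + n.*2.-1 = (j + n).*2.+1 by lia.
    have [_ ->] := thue_morse_double (j + n); have [_ ->] := thue_morse_double j.
    by rewrite eq_j.
  (* The window is the last five letters, then the first five; 8 is the smallest size that [4 <= n]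
     allows. *)
  apply: le_trans le52 _; apply: (@attains_le_cce _ 8 _ (n.*2 - 5) 10) => //.
    by rewrite size_block; lia.
  have := attains_misaligned (~~ thue_morse j) (thue_morse (j + n.-1))
    (thue_morse (j + n.-2)) (thue_morse j.+1) (thue_morse j.+2).
  congr (attains _ _ _).
  have t0 k : thue_morse k.*2 = thue_morse k by case: (thue_morse_double k).
  have t1 k : thue_morse k.*2.+1 = ~~ thue_morse k by case: (thue_morse_double k).
  have left k : k < 5 -> circ (block thue_morse j.*2.+1 n.*2) (n.*2 - 5 + k)
      = thue_morse (j.*2.+1 + (n.*2 - 5 + k)).
    by move=> ltk; rewrite /circ size_block modn_small ?nth_block //; lia.
  have right k : k < 5 -> circ (block thue_morse j.*2.+1 n.*2) (n.*2 - 5 + (5 + k))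
      = thue_morse (j.*2.+1 + k).
    move=> ltk; rewrite /circ size_block addnA subnK; last lia.
    by rewrite modnDl modn_small ?nth_block //; lia.
  rewrite /block /mkseq /= -/(block _ _ _).
  rewrite (left 0) // (left 1) // (left 2) // (left 3) // (left 4) //.
  rewrite (right 0) // (right 1) // (right 2) // (right 3) // (right 4) //.
  rewrite -(t1 (j + n.-2)) -(t0 (j + n.-2)) -(t1 (j + n.-1)) -(t0 (j + n.-1)).
  rewrite -(t1 j.+1) -(t0 j.+1) -(t1 j.+2) -(t0 j.+2).
  have njE : ~~ thue_morse j = thue_morse (j + n).*2.
    by rewrite t0; move: neq_j; case: thue_morse; case: thue_morse.
  rewrite {1}njE -t1.
  do 9 (congr (_ :: _); first by congr thue_morse; lia).
  by congr [:: _]; congr thue_morse; lia.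
by rewrite add0n -muE; apply: le_trans (ge_e j) (le_cce_mu _).
Qed.

(** * Factors at a given distance *)

Lemma sub_iter_mu k j n s l : s + l <= 2 ^ k * n ->
  take l (drop s (iter k mu (block thue_morse j n)))
  = block thue_morse (2 ^ k * j + s) l.
Proof. by move=> le_n; rewrite iter_mu_thue_morse sub_block. Qed.

Definition bits : seq bool := [:: false; true].

(** From an offset below 16, up to 17 letters fit in the 32 letters of the fourth image of two
    consecutive letters, and all four pairs occur in [thue_morse]. *)
Definition words (n : nat) : seq (seq bool) :=
  [seq take n (drop s (iter 4 mu w)) |
     w <- [seq [:: a; b] | a <- bits, b <- bits], s <- iota 0 16].

Lemma wordsP n x : n <= 17 ->
  reflect (exists i, x = block thue_morse i n) (x \in words n).
Proof.
move=> le_n; apply: (iffP allpairsP) => [[[w s] [ww ws xE]]|[i ->]].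
  have {xE} -> : x = take n (drop s (iter 4 mu w)) := xE.
  have lts : s < 16 by move: ws; rewrite mem_iota.
  have [j ->] : exists j, w = block thue_morse j 2.
    move: ww; rewrite /= !inE.
    (* The first occurrences of 00, 01, 10 and 11. *)
    by case/or4P => /eqP ->; [exists 5|exists 0|exists 2|exists 1].
  by exists (2 ^ 4 * j + s); rewrite sub_iter_mu //; lia.
exists (block thue_morse (i %/ 16) 2, i %% 16); split; last first.
- rewrite -[RHS]/(take n (drop (i %% 16) (iter 4 mu (block thue_morse (i %/ 16) 2)))).
  rewrite sub_iter_mu; first by rewrite mulnC -divn_eq.
  by have := ltn_mod i 16; lia.
- by rewrite mem_iota ltn_mod.
- by rewrite /block /mkseq /=; do 2 case: (thue_morse _).
Qed.

(* By [thue_morse_double], the set of the pairs [context m j], j >= 0, determines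
   those for [m.*2] and [m.*2.+1]. *)
Definition context (m j : nat) : seq bool * seq bool :=
  (block thue_morse j 2, block thue_morse (j + m.-1) 3).

Definition contexts_at (m : nat) (D : seq (seq bool * seq bool)) : Prop :=
  (forall j, context m j \in D) /\ (forall x, x \in D -> exists j, x = context m j).

Definition all_contexts : seq (seq bool * seq bool) :=
  [seq (u, v) | u <- undup (words 2), v <- undup (words 3)].

Definition contexts1 : seq (seq bool * seq bool) :=
  [seq x <- all_contexts | x.1 == take 2 x.2].

(* Filtering [all_contexts] puts the result in a canonical order. *)
Definition step (D : seq (seq bool * seq bool)) (d : bool) :=
  let D' := [seq (take 2 (drop s (mu x.1)), take 3 (drop (s + d).+1 (mu x.2))) |
               x <- D, s <- [:: 0; 1]] in
  [seq x <- all_contexts | x \in D'].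

Lemma mem_all_contexts x :
  (x \in all_contexts) = (x.1 \in words 2) && (x.2 \in words 3).
Proof.
rewrite /all_contexts; apply/allpairsP/andP => [[y [y1 y2 ->]]|[x1 x2]].
  by rewrite !mem_undup in y1 y2.
by exists x; rewrite !mem_undup x1 x2 -surjective_pairing.
Qed.

Lemma context_all m j : context m j \in all_contexts.
Proof.
rewrite mem_all_contexts; apply/andP; split; apply/wordsP => //.
  by exists j.
by exists (j + m.-1).
Qed.

Lemma contexts_at1 : contexts_at 1 contexts1.
Proof.
have cE j : context 1 j = (block thue_morse j 2, block thue_morse j 3).
  by rewrite /context (_ : j + 1.-1 = j) // addn0.
split=> [j|[u v]]; rewrite mem_filter.
  by rewrite context_all cE andbT; apply/eqP.
rewrite mem_all_contexts => /and3P[/eqP /= -> _ /wordsP[//|j ->]].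
by exists j; rewrite cE.
Qed.

(** The image of the second block starts at [2 * (j + m.-1)], which is [(s + d).+1] before the
    second block of the new context; both new blocks fit in the images. *)
Lemma step_context m j s (d : bool) : 0 < m -> s <= 1 ->
  (take 2 (drop s (mu (context m j).1)),
   take 3 (drop (s + d).+1 (mu (context m j).2)))
  = context (nat_of_bool d + m.*2) (j.*2 + s).
Proof.
move=> m_gt0 les; rewrite -[mu (context m j).1]/(iter 1 mu _).
rewrite -[mu (context m j).2]/(iter 1 mu _) !sub_iter_mu; [|lia|lia].
congr (block _ _ _, block _ _ _); first by rewrite mul2n.
by case: d; lia.
Qed.

Lemma contexts_at_step m D (d : bool) : 0 < m -> contexts_at m D ->
  contexts_at (d + m.*2) (step D d).
Proof.
move=> m_gt0 [mD Dm]; split=> [j|x]; rewrite mem_filter.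
  rewrite context_all andbT; apply/allpairsP.
  exists (context m j./2, nat_of_bool (odd j)); split=> //=.
    by case: odd.
  rewrite step_context //; last by case: odd.
  by rewrite [j./2.*2 + _]addnC odd_double_half.
case/andP => /allpairsP[[y s] /= [/Dm[j ->] + ->]] _.
rewrite !inE => les; exists (j.*2 + s); rewrite step_context //.
by case/orP: les => /eqP ->.
Qed.

(* The states 1, ..., 24 are reached by 1, 2, 3, 4, 5, 6, 7, 8, 9, 10, 11, 13, 14,
   16, 17, 18, 19, 20, 23, 32, 46, 65, 130, 260, in this order. *)
Definition delta_table : seq (nat * nat) :=
  [:: (0, 1); (2, 3); (4, 5); (6, 7); (8, 9); (10, 11); (6, 12); (13, 11);
      (14, 15); (16, 17); (18, 12); (16, 19); (13, 17); (13, 12); (20, 12);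
      (10, 17); (16, 12); (13, 19); (16, 9); (21, 19); (14, 22); (21, 12);
      (23, 17); (24, 12); (13, 9)].

Definition out_table : seq (nat * nat) :=
  [:: (1, 1); (1, 1); (1, 1); (2, 1); (2, 1); (5, 2); (2, 1); (7, 3);
      (2, 1); (5, 2); (5, 2); (5, 2); (7, 3); (7, 3); (2, 1);
      (5, 2); (5, 2); (7, 3); (5, 2); (17, 7); (2, 1); (17, 7);
      (7, 3); (7, 3); (7, 3)].

(** * The run of the automaton and the contexts that accompany its states *)

Definition delta (q : nat) (d : bool) : nat :=
  let e := nth (0, 0) delta_table q in if d then e.2 else e.1.

Definition out (q : nat) : nat * nat := nth (1, 1) out_table q.

Definition state (n : nat) : nat :=
  foldl delta 0 [seq odd (nat_of_ord d) | d <- base2 n].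

Lemma base2_half n : 1 < n -> base2 n = rcons (base2 n./2) (inZp n).
Proof.
move=> n_gt1; have logE : trunc_log 2 n = (trunc_log 2 n./2).+1.
  exact: trunc_log2S.
rewrite /base2 logE /mkseq -[(trunc_log 2 n./2).+2]add1n iotaD map_cat rev_cat.
rewrite [rev [seq _ | _ <- iota 0 1]]/= divn1 cats1; congr (rcons (rev _) _).
rewrite [0 + 1]addnC iotaDl -map_comp; apply: eq_map => i; apply: val_inj => /=.
by rewrite add1n expnS divnMA divn2.
Qed.

Lemma state_half n : 1 < n -> state n = delta (state n./2) (odd n).
Proof.
move=> n_gt1; rewrite /state base2_half // map_rcons foldl_rcons /=.
by rewrite modn2 oddb.
Qed.

(** Pairs of a state and a context set produced by the same digits. Twelve rounds suffice for
    closure, which [reachable_step] verifies. *)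
Definition reachable : seq (nat * seq (seq bool * seq bool)) :=
  Eval vm_compute in
  iter 12 (fun l => undup (l ++ [seq (delta x.1 d, step x.2 d) | x <- l, d <- bits]))
       [:: (1, contexts1)].

Lemma reachable1 : (1, contexts1) \in reachable.
Proof. by vm_compute. Qed.

Lemma reachable_step : all (fun x =>
  all (fun d => (delta x.1 d, step x.2 d) \in reachable) bits) reachable.
Proof. by vm_compute. Qed.

Lemma mem_bits b : b \in bits.
Proof. by case: b. Qed.

Lemma state_reachable m : 0 < m ->
  exists2 D, (state m, D) \in reachable & contexts_at m D.
Proof.
elim/ltn_ind: m => m IHm m_gt0; have [m_gt1|] := ltnP 1 m; last first.
  move=> le_m1; have -> : m = 1 by lia.
  by exists contexts1; [exact: reachable1|exact: contexts_at1].
have [D rD mD] := IHm m./2 ltac:(lia) ltac:(lia).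
exists (step D (odd m)).
  rewrite state_half //.
  exact: (allP (allP reachable_step _ rD) _ (mem_bits _)).
rewrite -{1}(odd_double_half m); apply: contexts_at_step mD; lia.
Qed.

(** * Odd lengths through the window around the junction *)

(** For [x = context m j], these are the last 16 and the first 17 letters of the factor of length
    [16 * m + r] at position [16 * j + s]. *)
Definition windows (x : seq bool * seq bool) (r s : nat) :=
  (take 16 (drop (s + r) (iter 4 mu x.2)), take 17 (drop s (iter 4 mu x.1))).

(** Here [a] counts the letters of the forbidden word that lie before the junction. *)
Definition clash (v u : seq bool) : bool :=
  lazy_has (fun a => drop (16 - a) v ++ take (5 - a) u \in
    [:: [:: false; false; true; false; false]; [:: true; true; false; true; true]])
    (iota 1 4).

Definition nibble (w : seq bool) : nat :=
  foldl (fun m (b : bool) => b + m.*2) 0 w.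

Definition odd_nibbles : seq (seq bool) :=
  [seq a :: x | a <- bits, x <- [seq [:: b; c; true] | b <- bits, c <- bits]].

(** Repetitions are kept within 17 letters so that they fit in the shortest circular word
    concerned. *)
Lemma odd_attains :
  all (fun X => all (fun w => let e := out (foldl delta X.1 w) in
    all (fun x => all (fun s => let vu := windows x (nibble w) s in
      attains e 17 (vu.1 ++ vu.2)) (iota 0 16)) X.2) odd_nibbles) reachable.
Proof. by vm_compute. Qed.

(** One factor per length suffices for the upper bound; the three conditions are the hypotheses of
    [cce_le_junction]. *)
Lemma odd_avoids :
  all (fun X => all (fun w => let e := out (foldl delta X.1 w) in
    (7 * e.2 <= 3 * e.1) &&
    lazy_has (fun x => lazy_has (fun s => let vu := windows x (nibble w) s in
      if clash vu.1 vu.2 then avoids e 33 8 (vu.1 ++ vu.2) else false)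
      (iota 0 16)) X.2) odd_nibbles) reachable.
Proof. by vm_compute. Qed.

Lemma odd_attainsP q D w x s :
  (q, D) \in reachable -> w \in odd_nibbles -> x \in D -> s < 16 ->
  attains (out (foldl delta q w)) 17
    ((windows x (nibble w) s).1 ++ (windows x (nibble w) s).2).
Proof.
move=> rD ww xD lts; have s16 : s \in iota 0 16 by rewrite mem_iota.
exact: (allP (allP (allP (allP odd_attains _ rD) _ ww) _ xD) _ s16).
Qed.

Lemma odd_avoidsP q D w : (q, D) \in reachable -> w \in odd_nibbles ->
  let e := out (foldl delta q w) in
  exists x s, let vu := windows x (nibble w) s in
  [/\ x \in D, s < 16, 7 * e.2 <= 3 * e.1, clash vu.1 vu.2
    & avoids e 33 8 (vu.1 ++ vu.2)].
Proof.
move=> rD ww e; have /andP[le73] := allP (allP odd_avoids _ rD) _ ww.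
rewrite lazy_hasE => /hasP[x xD]; rewrite lazy_hasE => /hasP[s].
rewrite mem_iota => lts /andP[cl av].
by exists x, s.
Qed.

(** These are the even lengths below 8 and the odd ones below 17, which neither halving to a length
    at least 4 nor the window reaches. All conjugates of [x] occur in [x ++ x]. *)
Lemma small_attains_avoids :
  all (fun n => let e := out (state n) in
     all (fun x => attains e n (x ++ x)) (words n)
       && has (fun x => avoids e n n (x ++ x)) (words n))
    [:: 1; 2; 3; 4; 5; 6; 7; 9; 11; 13; 15].
Proof. by vm_compute. Qed.

Lemma thue_morse_clash i :
  block thue_morse i 5 \notin
    [:: [:: false; false; true; false; false]; [:: true; true; false; true; true]].
Proof.
have /allP cl : all (fun x => x \notin
    [:: [:: false; false; true; false; false]; [:: true; true; false; true; true]])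
    (words 5) by vm_compute.
by apply: cl; apply/wordsP => //; exists i.
Qed.

(* A repetition of exponent more than 7/3 and period p >= 9 that crosses the
   junction extends far enough on one side for its period to carry the clash
   at the junction into [thue_morse]. *)
Lemma cce_le_junction e n i : 17 <= n -> 0 < e.2 -> 7 * e.2 <= 3 * e.1 ->
  clash (block thue_morse (i + (n - 16)) 16) (block thue_morse i 17) ->
  avoids e 33 8
    (block thue_morse (i + (n - 16)) 16 ++ block thue_morse i 17) ->
  (cce (block thue_morse i n) <= ratio e)%R.
Proof.
move=> le_n e_gt0 le73; rewrite junction_circ; [|lia|lia].
rewrite /clash lazy_hasE => /hasP[a]; rewrite mem_iota => lea.
rewrite drop_block ?take_block; [|lia|lia].
have -> : i + (n - 16) + (16 - a) = i + (n - a) by lia.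
have -> : 16 - (16 - a) = a by lia.
rewrite junction_circ; [|lia|lia].
have -> : a + (5 - a) = 5 by lia.
set x := block _ i n => cl av.
have szx : size x = n := size_block _ _ _.
have left k : k < n -> circ x k = thue_morse (i + k) by apply: circ_block_left.
have right k : k < n -> circ x (n + k) = thue_morse (i + k).
  exact: circ_block_right.
apply: cce_le => [|i0 p l]; first by rewrite seq_neq0 szx; lia.
rewrite szx => lti lep lel pr; rewrite ratio_le //=; last lia.
rewrite leqNgt; apply/negP => lt_e.
have p_gt0 : 0 < p by lia.
have lt73 : 7 * p < 3 * l by nia.
(* A part of the repetition that can be read in [thue_morse] is no overlap. *)
have short j s l' : s + l' <= l -> (forall k, k < l' ->
    circ x (i0 + s + k) = thue_morse (j + k)) -> l' <= p.*2.
  move=> le_l tE; rewrite leqNgt; apply/negP => lt_l.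
  by apply: (thue_morse_overlap_free p_gt0 lt_l (eq_rep tE (rep_sub le_l pr))).
have [in_x|cross] := leqP (i0 + l) n.
  have : l <= p.*2; last lia.
  apply: (short (i + i0) 0) => [|k ltk]; first lia.
  by rewrite addn0 left ?addnA //; lia.
have d1_le : n - i0 <= p.*2.
  apply: (short (i + i0) 0); first lia.
  by move=> k ltk; rewrite addn0 left ?addnA //; lia.
have d2_le : i0 + l - n <= p.*2.
  apply: (short i (n - i0)); first lia.
  by move=> k ltk; rewrite subnKC ?(ltnW lti) // right //; lia.
(* For [p <= 8] each side of the junction holds at most 16 letters of the repetition, which thus
   lies in the window. *)
have [le_p8|lt_8p] := leqP p 8.
  have e_ge1 : e.2 <= e.1 by lia.
  have := @avoids_rep e 33 8 (circ x) (n - 16) (16 + 17) p l e_ge1 e_gt0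
    isT av ltac:(lia) lt_e ltac:(lia) (i0 - (n - 16)) ltac:(lia).
  by have -> : n - 16 + (i0 - (n - 16)) = i0 by lia.
(* Each side holds more than [p / 3], hence at least 4 letters, so the repetition covers the clash;
   it remains to find room for its shift by [p] on one side. *)
have [right_copy|no_right] := leqP (n - i0 + p + (5 - a)) l.
  suff E : block (circ x) (n - a) 5 = block thue_morse (i + (p - a)) 5.
    by have := thue_morse_clash (i + (p - a)); rewrite -E cl.
  apply: eq_block => k ltk; rewrite -addnA -right; last lia.
  have := pr (n - a + k - i0) ltac:(lia).
  have -> : i0 + (n - a + k - i0) = n - a + k by lia.
  by move=> ->; congr (circ x _); lia.
have [left_copy|no_left] := leqP (i0 + l - n + p + a) l.
  suff E : block (circ x) (n - a) 5 = block thue_morse (i + (n - p - a)) 5.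
    by have := thue_morse_clash (i + (n - p - a)); rewrite -E cl.
  apply: eq_block => k ltk; rewrite -addnA -left; last lia.
  have := pr (n - p - a + k - i0) ltac:(lia).
  have -> : i0 + (n - p - a + k - i0) = n - p - a + k by lia.
  by move=> ->; congr (circ x _); lia.
(* With no room on either side [l <= 2 * p + 3], and [7 * p < 3 * l] then forces [p < 9]. *)
lia.
Qed.

Lemma out_gt0 q : 0 < (out q).2.
Proof.
have [ltq|geq] := ltnP q (size out_table); last by rewrite /out nth_default.
by apply: (all_nthP (a := fun e => 0 < e.2) (1, 1) _ _ ltq).
Qed.

Lemma out_ge1 q : (out q).2 <= (out q).1.
Proof.
have [ltq|geq] := ltnP q (size out_table); last by rewrite /out nth_default.
by apply: (all_nthP (a := fun e => e.2 <= e.1) (1, 1) _ _ ltq).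
Qed.

Lemma windowsE m j r s : 0 < m -> s < 16 -> r < 16 ->
  ((windows (context m j) r s).1 =
     block thue_morse (16 * j + s + (16 * m + r - 16)) 16)
  * ((windows (context m j) r s).2 = block thue_morse (16 * j + s) 17).
Proof.
move=> m_gt0 lts ltr; split.
  apply: etrans (@sub_iter_mu 4 (j + m.-1) 3 (s + r) 16 _) _; first lia.
  by congr block; lia.
by apply: (@sub_iter_mu 4 j 2 s 17); lia.
Qed.

Lemma least_cce_odd n : 17 <= n -> odd n -> least_cce n (ratio (out (state n))).
Proof.
move=> le_n odd_n; set m := n./2./2./2./2.
have m_gt0 : 0 < m by lia.
pose w := [:: odd n./2./2./2; odd n./2./2; odd n./2; true].
have wE : w \in odd_nibbles.
  by rewrite /w; case: odd; case: odd; case: odd.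
have lt_w : nibble w < 16 by rewrite /w; case: odd; case: odd; case: odd.
have nE : n = 16 * m + nibble w by rewrite /w /m /nibble /=; lia.
have sE : state n = foldl delta (state m) w.
  by rewrite 4?state_half /= ?odd_n //; lia.
have [D rD [mD Dm]] := state_reachable m_gt0.
clearbody w; split.
  have [x [s [/Dm[j ->] lts]]] := odd_avoidsP rD wE.
  rewrite !windowsE // -sE -nE => le73 cl av; exists (16 * j + s).
  exact: cce_le_junction (out_gt0 _) le73 cl av.
move=> i; have := odd_attainsP rD wE (mD (i %/ 16)) (ltn_pmod i (isT : 0 < 16)).
rewrite !windowsE ?ltn_mod // -nE -sE mulnC -divn_eq.
rewrite junction_circ; [|lia|lia].
by apply: attains_le_cce; rewrite ?out_gt0 ?size_block.
Qed.

Lemma least_cce_small n :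
  n \in [:: 1; 2; 3; 4; 5; 6; 7; 9; 11; 13; 15] ->
  least_cce n (ratio (out (state n))).
Proof.
move=> n_in; have /andP[/allP att /hasP[x xw av]] := allP small_attains_avoids _ n_in.
have le_n : 0 < n <= 17 by move: n_in; rewrite !inE; lia.
have n17 : n <= 17 by lia.
set e := out (state n) in att av *; have e_gt0 : 0 < e.2 := out_gt0 _.
have e_ge1 : e.2 <= e.1 := out_ge1 _.
split; last first.
  move=> i; have := att (block thue_morse i n) _.
  move=> /(_ (introT (wordsP _ n17) (ex_intro _ i erefl))).
  rewrite self_cat_circ size_block.
  by apply: attains_le_cce; rewrite ?size_block // leq_addr.
have [i xE] := wordsP _ n17 xw; exists i; rewrite -xE.
have szx : size x = n by rewrite xE size_block.
rewrite self_cat_circ szx in av.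
apply: cce_le => [|i0 p l]; first by rewrite seq_neq0 szx; lia.
rewrite szx => lti lep lel pr.
rewrite ratio_le //=; last lia.
rewrite leqNgt; apply/negP => lt_e.
have := @avoids_rep e n n (circ x) 0 (n + n) p l e_ge1 e_gt0
  ltac:(lia) av ltac:(lia) lt_e ltac:(lia) i0 ltac:(lia).
by rewrite add0n.
Qed.

(** * Even lengths by halving, and all lengths together *)

Lemma delta_lt q d : delta q d < 25.
Proof.
rewrite /delta; have [ltq|geq] := ltnP q (size delta_table); last first.
  by rewrite nth_default //; case: d.
have := all_nthP (a := fun e => (e.1 < 25) && (e.2 < 25)) (0, 0) _ _ ltq.
by case: d => /(_ isT) /andP[].
Qed.

(** Supplies what [least_cce_double] needs: a final digit 0 keeps the output, which lies between 2
    and 5/2. States 1 and 2 output 1 and must be left out. *)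
Lemma delta_gt2 : all (fun q => [&& 2 < delta q false, 2 < delta q true,
    out (delta q false) == out q, 2 * (out q).2 <= (out q).1
  & 2 * (out q).1 <= 5 * (out q).2]) (iota 3 22).
Proof. by vm_compute. Qed.

Lemma state_gt2 n : 2 < n -> 2 < state n < 25.
Proof.
elim/ltn_ind: n => n IHn n_gt2; rewrite state_half ?delta_lt ?andbT; last lia.
have [half_gt2|] := ltnP 2 n./2; last first.
  move=> half_le2; have : n \in [:: 3; 4; 5] by rewrite !inE; lia.
  by rewrite !inE => /or3P[] /eqP ->.
have /andP[s_gt2 s_lt] := IHn n./2 ltac:(lia) half_gt2.
have := allP delta_gt2 (state n./2); rewrite mem_iota s_gt2 => /(_ s_lt).
by case/and5P; case: odd.
Qed.

Lemma least_cce_state n : 0 < n -> least_cce n (ratio (out (state n))).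
Proof.
elim/ltn_ind: n => n IHn n_gt0.
have [|n_big] := boolP (n \in [:: 1; 2; 3; 4; 5; 6; 7; 9; 11; 13; 15]).
  exact: least_cce_small.
rewrite !inE in n_big.
have [odd_n|even_n] := boolP (odd n); first by apply: least_cce_odd => //; lia.
have /andP[s_gt2 s_lt] := @state_gt2 n./2 ltac:(lia).
have := allP delta_gt2 (state n./2); rewrite mem_iota s_gt2 => /(_ s_lt).
case/and5P=> _ _ /eqP outE ge2 le52.
have -> : state n = delta (state n./2) false.
  by rewrite state_half ?(negPf even_n) //; lia.
rewrite outE; have := IHn n./2 ltac:(lia) ltac:(lia).
have {3}-> : n = n./2.*2 by lia.
apply: least_cce_double; first lia.
  by rewrite ratio_le ?out_gt0 //= muln1.
by rewrite ratio_le ?out_gt0 //= mulnC.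
Qed.

Lemma least_cce_minimum n e : least_cce n e ->
  is_minimum (fun r : rat => exists x, tm_factor x /\ size x = n /\ cce x = r) e.
Proof.
move=> [[i le_e] ge_e]; split.
  exists (block thue_morse i n); rewrite /tm_factor size_block; split.
    by exists i.
  by split=> //; apply/le_anti; rewrite le_e ge_e.
by move=> r [x [[j xE] [szx <-]]]; rewrite xE szx.
Qed.

(** * The tables packaged as a [dfao] *)

Definition tm_trans (q : 'I_25) (d : 'I_2) : 'I_25 := inord (delta q (odd d)).

Lemma tm_outP (q : 'I_25) : ratio (out q) \in [seq ratio e | e <- out_table].
Proof. by apply: map_f; apply: mem_nth. Qed.

Definition tm_dfao : dfao 2 rat :=
  @Dfao 2 rat 'I_25 tm_trans ord0 [seq ratio e | e <- out_table]
    (fun q => ratio (out q)) tm_outP.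

Lemma tm_dfao_run w :
  dfao_run tm_dfao w = ratio (out (foldl delta 0 [seq odd (nat_of_ord d) | d <- w])).
Proof.
rewrite /dfao_run /=; congr (ratio (out _)).
have run (q : 'I_25) : nat_of_ord (foldl tm_trans q w)
    = foldl delta q [seq odd (nat_of_ord d) | d <- w].
  by elim: w q => //= d w IHw q; rewrite IHw inordK ?delta_lt.
exact: run.
Qed.

Theorem theorem13 :
  exists M : dfao 2 rat,
    #|dfao_state M| = 25 /\
    forall n : nat, 1 <= n ->
      is_minimum
        (fun r : rat => exists x : seq bool,
           tm_factor x /\ size x = n /\ cce x = r)
        (dfao_run M (base2 n)).
Proof.
exists tm_dfao; split; first exact: card_ord.
move=> n n_gt0; rewrite tm_dfao_run.
exact/least_cce_minimum/least_cce_state.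
Qed.
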